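(* Let $P:\mathcal M\times\mathcal M\to\{0,1\}$ be a binary predicate computable by a polynomial-size circuit and let $\Pi_{\mathsf{CondEnc}}$ be the conditional encryption construction for $P$ from a fully homomorphic encryption scheme $\Pi_{\mathsf{FHE}}=(\mathsf{KeyGen},\mathsf{Enc},\mathsf{Eval},\mathsf{Dec})$ described in the context. Assume that $\Pi_{\mathsf{FHE}}$ is $\epsilon(\lambda)$-circuit-private. Then $\Pi_{\mathsf{CondEnc}}$ provides $(\infty,t_{\mathsf{Sim}},\epsilon(\lambda))$-conditional encryption secrecy, where $t_{\mathsf{Sim}}$ denotes the running time of the simulator for the circuit-private FHE scheme.
   Context: **Conditional encryption secrecy.** A conditional encryption scheme for $P$ consists of $(\mathsf{KeyGen},\mathsf{Enc},\mathsf{CondEnc},\mathsf{Dec})$, where $\mathsf{Enc}_{pk}(m)$ outputs a ciphertext with flag $0$ and $\mathsf{CondEnc}_{pk}(c,m_2,m_3)$ takes a flag-$0$ ciphertext, a control message $m_2$ and a payload $m_3$ and outputs a ciphertext with flag $1$. It provides $(t,t_{\mathsf{Sim}},\epsilon)$-conditional encryption secrecy if there is a simulator $\mathsf{Sim}$ running in time at most $t_{\mathsf{Sim}}(\lambda)$ such that for all $m_1,m_2,m_3\in\mathcal M$ with $P(m_1,m_2)=0$, all $\lambda$, all coins $r,r_1$, and all distinguishers $\mathcal D$ running in time at most $t(\lambda)$ ($t=\infty$: unbounded), with $(sk,pk)=\mathsf{KeyGen}(1^\lambda;r)$ and $c_1=\mathsf{Enc}_{pk}(m_1;r_1)$, $$\big|\Pr[\mathcal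 D(sk,pk,m_1,m_2,m_3,c_1,\mathsf{Sim}(pk))=1]-\Pr[\mathcal D(sk,pk,m_1,m_2,m_3,c_1,\mathsf{CondEnc}_{pk}(c_1,m_2,m_3))=1]\big|\le\epsilon,$$ probabilities over the coins of $\mathcal D$, $\mathsf{Sim}$ and $\mathsf{CondEnc}$. **Circuit privacy.** A homomorphic encryption scheme for a class of circuits $\mathcal C$ is $\epsilon(\lambda)$-circuit private if there is a (possibly unbounded) simulator $\mathsf{Sim}$ such that for all key pairs $(sk,pk)$ in the support of $\mathsf{KeyGen}(1^\lambda)$, any circuit $C\in\mathcal C$, any plaintexts $m_1,\dots,m_n$, any fixed ciphertexts $c_1,\dots,c_n$ with $c_i$ in the image of $\mathsf{Enc}_{pk}(m_i)$, and any (unbounded) distinguisher $\mathcal D$, $$\big|\Pr[\mathcal D(sk,pk,c_1,\dots,c_n,m_1,\dots,m_n,\mathsf{Sim}(pk,C(m_1,\dots,m_n)))=1]-\Pr[\mathcal D(sk,pk,c_1,\dots,c_n,m_1,\dots,m_n,\mathsf{Eval}_{pk}(C,c_1,\dots,c_n))=1]\big|\le\epsilon(\lambda),$$ over the coins of $\mathcal D$, $\mathsf{Sim}$, $\mathsf{Eval}$. **The construction.** $Z$ is an arbitrary fixed, publicly known constant in the FHE message space (which contains $\mathcal M$). $C_{P,m_2,m_3}$ is the circuit that on input $m_1$ outputs $m_3$ if $P(m_1,m_2)=1$ and $Z$ if $P(m_1,m_2)=0$; $\mathcal C$ contains all these circuits. - $\Pi_{\mathsf{CondEnc}}.\mathsf{KeyGen}(1^\lambda)$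 is the FHE key generation. - $\Pi_{\mathsf{CondEnc}}.\mathsf{Enc}_{pk}(m_1)=(0,\Pi_{\mathsf{FHE}}.\mathsf{Enc}_{pk}(m_1))$. - $\Pi_{\mathsf{CondEnc}}.\mathsf{CondEnc}_{pk}((0,c),m_2,m_3)=(1,\Pi_{\mathsf{FHE}}.\mathsf{Eval}_{pk}(C_{P,m_2,m_3},c))$. - $\Pi_{\mathsf{CondEnc}}.\mathsf{Dec}_{sk}(b,c)$: compute $m=\Pi_{\mathsf{FHE}}.\mathsf{Dec}_{sk}(c)$; return $\bot$ if $m\notin\mathcal M$, otherwise $m$. *)

(* Defs.v *)
From HB Require Import structures.
From mathcomp Require Import all_boot all_order all_algebra.
From mathcomp Require Import reals.
Set Implicit Arguments. Unset Strict Implicit. Unset Printing Implicit Defensive.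
Import Order.TTheory GRing.Theory Num.Theory.
Local Open Scope ring_scope.

Record distr (R : realType) (T : finType) := Distr {
  dmass :> T -> R;
  dmass_ge0 : forall x, 0 <= dmass x;
  dmass_sum1 : \sum_x dmass x = 1 }.

Lemma dbind_ge0 (R : realType) (T U : finType) (mu : distr R T)
  (K : T -> distr R U) (y : U) : 0 <= \sum_x mu x * K x y.
Proof. by apply: sumr_ge0 => x _; rewrite mulr_ge0 // dmass_ge0. Qed.

Lemma dbind_sum1 (R : realType) (T U : finType) (mu : distr R T)
  (K : T -> distr R U) : \sum_y \sum_x mu x * K x y = 1.
Proof.
rewrite exchange_big -[RHS](dmass_sum1 mu); apply: eq_bigr => x _ /=.
by rewrite -mulr_sumr dmass_sum1 mulr1.
Qed.

Definition dbind (R : realType) (T U : finType) (mu : distr R T)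
    (K : T -> distr R U) : distr R U :=
  Distr (dbind_ge0 mu K) (dbind_sum1 mu K).

Lemma dirac_ge0 (R : realType) (T : finType) (a x : T) : 0 <= (x == a)%:R :> R.
Proof. exact: ler0n. Qed.

Lemma dirac_sum1 (R : realType) (T : finType) (a : T) :
  \sum_x (x == a)%:R = 1 :> R.
Proof.
by rewrite (bigD1 a) //= eqxx big1 ?addr0 // => x /negPf ->.
Qed.

Definition dret (R : realType) (T : finType) (a : T) : distr R T :=
  Distr (@dirac_ge0 R T a) (dirac_sum1 R a).

Definition dmap (R : realType) (T U : finType) (f : T -> U) (mu : distr R T) :
    distr R U :=
  dbind mu (fun x => dret R (f x)).

Definition bits (n : nat) : finType := {ffun 'I_n -> bool}.

Lemma coins_ge0 (R : realType) (n : nat) (x : bits n) : 0 <= (2 ^+ n)^-1 :> R.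
Proof. by rewrite invr_ge0 exprn_ge0. Qed.

Lemma coins_sum1 (R : realType) (n : nat) :
  \sum_(x : bits n) (2 ^+ n)^-1 = 1 :> R.
Proof.
rewrite sumr_const card_ffun card_bool card_ord -[LHS]mulr_natr natrX mulVf //.
by rewrite expf_neq0 // pnatr_eq0.
Qed.

Definition dcoins (R : realType) (n : nat) : distr R (bits n) :=
  Distr (@coins_ge0 R n) (coins_sum1 R n).

(* Circuits over NAND with [I]-indexed input bits and [O]-indexed output bits.
   Gates are listed in evaluation order; a wire naming a gate that has not been
   evaluated yet carries [false].  As usual the size counts gates only, so that
   constants and input wires are free. *)
Inductive wire (I : finType) :=
  | WConst of bool
  | WInput of I
  | WGate of nat.

Record circuit (I O : finType) := Circuit {
  gates : seq (wire I * wire I);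
  outputs : O -> wire I }.

Definition csize (I O : finType) (C : circuit I O) : nat := size (gates C).

Definition wire_val (I : finType) (x : {ffun I -> bool}) (vals : seq bool)
    (w : wire I) : bool :=
  match w with
  | WConst b => b
  | WInput i => x i
  | WGate j => nth false vals j
  end.

Definition gate_vals (I : finType) (x : {ffun I -> bool})
    (gs : seq (wire I * wire I)) : seq bool :=
  foldl (fun vals g =>
    rcons vals (~~ (wire_val x vals g.1 && wire_val x vals g.2))) [::] gs.

Definition ceval (I O : finType) (C : circuit I O) (x : {ffun I -> bool}) :
    {ffun O -> bool} :=
  [ffun o => wire_val x (gate_vals x (gates C)) (outputs C o)].

Definition bcat (I J : finType) (x : {ffun I -> bool}) (y : {ffun J -> bool}) :
    {ffun I + J -> bool} :=
  [ffun s => match s with inl i => x i | inr j => y j end].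

HB.mixin Record hasBitEncoding (T : Type) := {
  bindex : finType;
  bcode : T -> {ffun bindex -> bool};
  bcode_inj : injective bcode }.

#[short(type="bitType")]
HB.structure Definition BitEncoded := {T of Finite T & hasBitEncoding T}.

Arguments bindex s : clear implicits.

HB.instance Definition _ (I : finType) :=
  hasBitEncoding.Build {ffun I -> bool} (@inj_id {ffun I -> bool}).

Lemma bool_code_inj : injective (fun b : bool => [ffun _ : unit => b]).
Proof. by move=> a b /ffunP/(_ tt); rewrite !ffunE. Qed.

HB.instance Definition _ := hasBitEncoding.Build bool bool_code_inj.

Lemma prod_code_inj (A B : bitType) :
  injective (fun p : A * B => bcat (bcode p.1) (bcode p.2)).
Proof.
move=> [a b] [c d] /= /ffunP E; congr pair; apply: bcode_inj; apply/ffunP => i.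
- by have := E (inl i); rewrite !ffunE.
- by have := E (inr i); rewrite !ffunE.
Qed.

HB.instance Definition _ (A B : bitType) :=
  hasBitEncoding.Build (A * B)%type (@prod_code_inj A B).

Inductive time := Steps of nat | Unbounded.

(* A randomized algorithm from [A] to [B] is given by its output distributions.
   Running time is measured non-uniformly, as the size of a circuit that reads
   the encoded input and uniform coins and outputs the encoded result. *)
Definition runs_within (R : realType) (A B : bitType) (K : A -> distr R B)
    (t : time) : Prop :=
  match t with
  | Unbounded => True
  | Steps s =>
      exists (n : nat) (C : circuit (bindex A + 'I_n)%type (bindex B)),
        (csize C <= s)%N /\
        forall (a : A) (b : B),
          K a b = dmap (fun r : bits n => ceval C (bcat (bcode a) r))
                       (dcoins R n) (bcode b)
  end.

(* [Pr[D (x) = 1]] for [x] drawn from [mu], over the coins of [D] and [mu]. *)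
Definition pr_accept (R : realType) (T : finType) (D : T -> distr R bool)
    (mu : distr R T) : R :=
  dbind mu D true.

(* Here and below [k] is the security parameter.  Plaintexts, keys and
   ciphertexts are strings of lengths depending on [k]; the plaintext space may
   be a proper subset of the strings of its length.  Key generation and
   encryption take their coins explicitly, so that supports and images are
   ranges; evaluation is given by its output distributions.  [he_circuits] is
   the class of circuits supported by the scheme; a circuit on [n] plaintexts
   has its input bits indexed by (plaintext, position).  Correctness and
   efficiency are not part of the structure. *)
Record he_scheme (R : realType) := HEScheme {
  he_msglen : nat -> nat;
  he_sklen : nat -> nat;
  he_pklen : nat -> nat;
  he_ctlen : nat -> nat;
  he_kgcoins : nat -> nat;
  he_enccoins : nat -> nat;
  he_msgs : forall k, {set bits (he_msglen k)};
  he_circuits : forall k n,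
    circuit ('I_n * 'I_(he_msglen k))%type 'I_(he_msglen k) -> Prop;
  he_keygen : forall k, bits (he_kgcoins k) ->
    bits (he_sklen k) * bits (he_pklen k);
  he_enc : forall k, bits (he_pklen k) -> bits (he_msglen k) ->
    bits (he_enccoins k) -> bits (he_ctlen k);
  he_eval : forall k n, bits (he_pklen k) ->
    circuit ('I_n * 'I_(he_msglen k))%type 'I_(he_msglen k) ->
    {ffun 'I_n -> bits (he_ctlen k)} -> distr R (bits (he_ctlen k));
  he_dec : forall k, bits (he_sklen k) -> bits (he_ctlen k) ->
    option (bits (he_msglen k)) }.

Definition capply (n l : nat) (C : circuit ('I_n * 'I_l)%type 'I_l)
    (m : {ffun 'I_n -> bits l}) : bits l :=
  ceval C [ffun p => m p.1 p.2].

(* Circuit privacy with a simulator of running time at most [tSim]; the usual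
   notion, with a possibly unbounded simulator, is
   [tSim = fun _ => Unbounded]. *)
Definition circuit_private (R : realType) (S : he_scheme R)
    (tSim : nat -> time) (eps : nat -> R) : Prop :=
  exists Sim : forall k, bits (he_pklen S k) * bits (he_msglen S k) ->
                 distr R (bits (he_ctlen S k)),
    (forall k, runs_within (Sim k) (tSim k)) /\
    forall (k : nat) (sk : bits (he_sklen S k)) (pk : bits (he_pklen S k)),
      (exists r, he_keygen r = (sk, pk)) ->
    forall (n : nat)
      (C : circuit ('I_n * 'I_(he_msglen S k))%type 'I_(he_msglen S k)),
      he_circuits C ->
    forall (m : {ffun 'I_n -> bits (he_msglen S k)})
      (c : {ffun 'I_n -> bits (he_ctlen S k)}),
      (forall i, m i \in he_msgs S k) ->
      (forall i, exists r, he_enc pk (m i) r = c i) ->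
    forall D : bits (he_sklen S k) * bits (he_pklen S k) *
               {ffun 'I_n -> bits (he_ctlen S k)} *
               {ffun 'I_n -> bits (he_msglen S k)} *
               bits (he_ctlen S k) -> distr R bool,
      `| pr_accept (fun x => D (sk, pk, c, m, x)) (Sim k (pk, capply C m))
         - pr_accept (fun x => D (sk, pk, c, m, x)) (he_eval pk C c) |
        <= eps k.

(* A ciphertext is a pair of a flag ([false] for 0, [true] for 1) and a string;
   the behaviour of [ce_condenc] on ciphertexts of flag 1 is irrelevant. *)
Record ce_scheme (R : realType) := CEScheme {
  ce_msglen : nat -> nat;
  ce_sklen : nat -> nat;
  ce_pklen : nat -> nat;
  ce_ctlen : nat -> nat;
  ce_kgcoins : nat -> nat;
  ce_enccoins : nat -> nat;
  ce_msgs : forall k, {set bits (ce_msglen k)};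
  ce_keygen : forall k, bits (ce_kgcoins k) ->
    bits (ce_sklen k) * bits (ce_pklen k);
  ce_enc : forall k, bits (ce_pklen k) -> bits (ce_msglen k) ->
    bits (ce_enccoins k) -> bool * bits (ce_ctlen k);
  ce_condenc : forall k, bits (ce_pklen k) -> bool * bits (ce_ctlen k) ->
    bits (ce_msglen k) -> bits (ce_msglen k) ->
    distr R (bool * bits (ce_ctlen k))%type;
  ce_dec : forall k, bits (ce_sklen k) -> bool * bits (ce_ctlen k) ->
    option (bits (ce_msglen k));
  ce_enc_flag : forall k (pk : bits (ce_pklen k)) (m : bits (ce_msglen k))
    (r : bits (ce_enccoins k)), (ce_enc pk m r).1 = false;
  ce_condenc_flag : forall k (pk : bits (ce_pklen k))
    (c : bool * bits (ce_ctlen k)) (m2 m3 : bits (ce_msglen k))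
    (c' : bits (ce_ctlen k)), ce_condenc pk c m2 m3 (false, c') = 0 }.

(* The predicate matters on the message space only; it is a total function on
   strings for convenience. *)
Definition ce_secrecy (R : realType) (Pi : ce_scheme R)
    (P : forall k, bits (ce_msglen Pi k) -> bits (ce_msglen Pi k) -> bool)
    (t tSim : nat -> time) (eps : nat -> R) : Prop :=
  exists Sim : forall k, bits (ce_pklen Pi k) ->
                 distr R (bool * bits (ce_ctlen Pi k))%type,
    (forall k, runs_within (Sim k) (tSim k)) /\
    forall (k : nat) (m1 m2 m3 : bits (ce_msglen Pi k)),
      m1 \in ce_msgs Pi k -> m2 \in ce_msgs Pi k -> m3 \in ce_msgs Pi k ->
      P k m1 m2 = false ->
    forall (r : bits (ce_kgcoins Pi k)) (r1 : bits (ce_enccoins Pi k))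
      (D : bits (ce_sklen Pi k) * bits (ce_pklen Pi k) *
           bits (ce_msglen Pi k) * bits (ce_msglen Pi k) *
           bits (ce_msglen Pi k) * (bool * bits (ce_ctlen Pi k)) *
           (bool * bits (ce_ctlen Pi k)) -> distr R bool),
      runs_within D (t k) ->
      let: (sk, pk) := ce_keygen r in
      let c1 := ce_enc pk m1 r1 in
      `| pr_accept (fun x => D (sk, pk, m1, m2, m3, c1, x)) (Sim k pk)
         - pr_accept (fun x => D (sk, pk, m1, m2, m3, c1, x))
             (ce_condenc pk c1 m2 m3) |
        <= eps k.

Arguments ce_secrecy {R} Pi P t tSim eps.

Definition polysize_predicate (l : nat -> nat) (M : forall k, {set bits (l k)})
    (P : forall k, bits (l k) -> bits (l k) -> bool) : Prop :=
  exists (q : {poly nat}) (C : forall k, circuit ('I_(l k) + 'I_(l k))%type unit),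
    forall k, (csize (C k) <= q.[k])%N /\
      forall m1 m2 : bits (l k), m1 \in M k -> m2 \in M k ->
        ceval (C k) (bcat m1 m2) tt = P k m1 m2.

(* [C k m2 m3] plays the role of the circuit C_{P,m2,m3}; since evaluation may
   depend on the wiring, any choice of circuits with the right input-output
   behaviour on the message space is allowed. *)
Definition conditional_circuits (l : nat -> nat) (M : forall k, {set bits (l k)})
    (P : forall k, bits (l k) -> bits (l k) -> bool) (Z : forall k, bits (l k))
    (C : forall k, bits (l k) -> bits (l k) ->
           circuit ('I_1 * 'I_(l k))%type 'I_(l k)) : Prop :=
  forall (k : nat) (m1 m2 m3 : bits (l k)),
    m1 \in M k -> m2 \in M k -> m3 \in M k ->
    capply (C k m2 m3) [ffun=> m1] = if P k m1 m2 then m3 else Z k.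

Lemma dmap_true_flag (R : realType) (T : finType) (mu : distr R T) (y : T) :
  dmap (pair true) mu (false, y) = 0.
Proof. by rewrite /= big1 // => x _; apply: mulr0. Qed.

Definition ce_of_he (R : realType) (S : he_scheme R)
    (M : forall k, {set bits (he_msglen S k)})
    (C : forall k, bits (he_msglen S k) -> bits (he_msglen S k) ->
           circuit ('I_1 * 'I_(he_msglen S k))%type 'I_(he_msglen S k)) :
    ce_scheme R :=
  {| ce_msglen := he_msglen S;
     ce_sklen := he_sklen S;
     ce_pklen := he_pklen S;
     ce_ctlen := he_ctlen S;
     ce_kgcoins := he_kgcoins S;
     ce_enccoins := he_enccoins S;
     ce_msgs := M;
     ce_keygen := fun k r => he_keygen r;
     ce_enc := fun k pk m1 r1 => (false, he_enc pk m1 r1);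
     ce_condenc := fun k pk c m2 m3 =>
       dmap (pair true) (he_eval pk (C k m2 m3) [ffun=> c.2]);
     ce_dec := fun k sk c =>
       if he_dec sk c.2 is Some m then if m \in M k then Some m else None
       else None;
     ce_enc_flag := fun k pk m r => erefl;
     ce_condenc_flag := fun k pk c m2 m3 c' => dmap_true_flag _ c' |}.

(* Main.v *)
(** The simulator runs the circuit-privacy simulator on the constant [Z] and
    raises the flag.  When [P m1 m2 = 0] the circuit evaluates to [Z] on [m1],
    so circuit privacy applies to the distinguisher that adds the flag to its
    challenge.  Wiring in the bits of [Z] and the flag costs no gates, so the
    running time is unchanged. *)
Require Import Defs.
From mathcomp Require Import all_boot all_order all_algebra.
From mathcomp Require Import reals.

Set Implicit Arguments. Unset Strict Implicit. Unset Printing Implicit Defensive.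

Import GRing.Theory.

Lemma dmapE (R : realType) (T U : finType) (f : T -> U) (mu : distr R T) y :
  dmap f mu y = (\sum_(x | f x == y) mu x)%R.
Proof.
rewrite /= [RHS]big_mkcond; apply: eq_bigr => x _.
by rewrite eq_sym; case: eqP => _; rewrite ?mulr1 ?mulr0.
Qed.

Lemma dmap_inj (R : realType) (T U : finType) (f : T -> U) (mu : distr R T) x :
  injective f -> dmap f mu (f x) = mu x.
Proof.
by move=> f_inj; rewrite dmapE (big_pred1 x) // => z; rewrite /= inj_eq.
Qed.

(** Deterministic post-processing of the challenge is absorbed into the distinguisher; this is how
    the flag is disposed of. *)
Lemma pr_accept_dmap (R : realType) (T U : finType) (f : T -> U)
    (D : U -> distr R bool) (mu : distr R T) :
  pr_accept D (dmap f mu) = pr_accept (fun x => D (f x)) mu.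
Proof.
rewrite /pr_accept /=; under eq_bigr do rewrite mulr_suml.
rewrite exchange_big; apply: eq_bigr => x _ /=.
rewrite (bigD1 (f x)) //= eqxx mulr1 big1 ?addr0 // => y /negPf ->.
by rewrite mulr0 mul0r.
Qed.

Section Rewiring.
Variables (I J : finType) (f : I -> J + bool).

(** Hard-wiring of inputs: each input wire becomes another input or a constant. Gate references stay
    as they are, so the gate list keeps its length and order. *)
Definition rewire (w : wire I) : wire J :=
  match w with
  | WConst b => WConst J b
  | WInput i => match f i with inl j => WInput j | inr b => WConst J b end
  | WGate n => WGate J n
  end.

Definition rewired_input (x : {ffun J -> bool}) : {ffun I -> bool} :=
  [ffun i => match f i with inl j => x j | inr b => b end].

Definition rewire_gates (gs : seq (wire I * wire I)) :=
  [seq (rewire g.1, rewire g.2) | g <- gs].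

Lemma wire_val_rewire x vals w :
  wire_val x vals (rewire w) = wire_val (rewired_input x) vals w.
Proof. by case: w => //= i; rewrite ffunE; case: (f i). Qed.

Lemma gate_vals_rewire x gs :
  gate_vals x (rewire_gates gs) = gate_vals (rewired_input x) gs.
Proof.
rewrite /gate_vals; elim: gs [::] => //= g gs IH vals.
by rewrite IH !wire_val_rewire.
Qed.

End Rewiring.

(** The bits of [bcode b] are hard-wired into the circuit for [K]; the coins and the number of gates
    do not change. *)
Lemma runs_within_partial (R : realType) (A B O : bitType)
    (K : A * B -> distr R O) (b : B) (t : time) :
  runs_within K t -> runs_within (fun a => K (a, b)) t.
Proof.
case: t => // s [n [C [sizeC KE]]].
pose f (i : (bindex A + bindex B) + 'I_n) : (bindex A + 'I_n) + bool :=
  match i with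
  | inl (inl j) => inl (inl j)
  | inl (inr j) => inr (bcode b j)
  | inr j => inl (inr j)
  end.
exists n, (Circuit (rewire_gates f (gates C)) (fun o => rewire f (outputs C o))).
split=> [|a o]; first by rewrite /csize size_map.
rewrite KE !dmapE; apply: eq_bigl => r; congr (_ == _).
apply/ffunP => j; rewrite !ffunE wire_val_rewire gate_vals_rewire /=.
suff -> : rewired_input f (bcat (bcode a) r) = bcat (bcode (a, b)) r by [].
by apply/ffunP => -[[i|i]|i]; rewrite !ffunE /= ?ffunE.
Qed.

(** The flag is one more output wire, fed by a constant, over the same gates. *)
Lemma runs_within_tag (R : realType) (A B : bitType) (K : A -> distr R B)
    (b : bool) (t : time) :
  runs_within K t -> runs_within (fun a => dmap (pair b) (K a)) t.
Proof.
case: t => // s [n [C [sizeC KE]]].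
(* A boolean is encoded by a single bit indexed by [unit], so this sum is the index type for
   [bool * B]. *)
exists n, (@Circuit _ (unit + bindex B)%type (gates C) (fun o =>
  match o with inl _ => WConst _ b | inr j => outputs C j end)).
split=> // a [b' y]; set C' := Circuit _ _.
have C'E x : ceval C' x = bcat [ffun=> b] (ceval C x).
  by apply/ffunP => -[u|j]; rewrite !ffunE.
(* With the right flag, the same coins produce [y] before and after tagging; with the wrong flag,
   both masses are empty sums. *)
case: (eqVneq b' b) => [->|neq_b].
  rewrite dmap_inj => [|u v [//]]; rewrite KE !dmapE; apply: eq_bigl => r.
  rewrite C'E; apply/eqP/eqP => [->|/ffunP E].
    by apply/ffunP => -[u|j]; rewrite !ffunE.
  by apply/ffunP => j; have := E (inr j); rewrite !ffunE.
rewrite !dmapE !big_pred0 // => [r|x]; apply/negbTE/eqP.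
  rewrite C'E => /ffunP/(_ (inl tt)); rewrite !ffunE => E.
  by rewrite E eqxx in neq_b.
by case=> E; rewrite E eqxx in neq_b.
Qed.

Theorem theorem13 (R : realType) (S : he_scheme R)
    (M : forall k, {set bits (he_msglen S k)})
    (P : forall k, bits (he_msglen S k) -> bits (he_msglen S k) -> bool)
    (Z : forall k, bits (he_msglen S k))
    (C : forall k, bits (he_msglen S k) -> bits (he_msglen S k) ->
           circuit ('I_1 * 'I_(he_msglen S k))%type 'I_(he_msglen S k))
    (tSim : nat -> time) (eps : nat -> R) :
  (forall k, M k \subset he_msgs S k) ->
  polysize_predicate M P ->
  (forall k, Z k \in he_msgs S k) ->
  conditional_circuits M P Z C ->
  (forall k m2 m3, m2 \in M k -> m3 \in M k -> he_circuits (C k m2 m3)) ->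
  circuit_private S tSim eps ->
  ce_secrecy (ce_of_he M C) P (fun=> Unbounded) tSim eps.
Proof.
move=> sub_M _ _ CE C_ok [Sim [SimT priv]].
exists (fun k pk => dmap (pair true) (Sim k (pk, Z k))); split=> [k|].
  exact/runs_within_tag/(@runs_within_partial _ _ _ _ (Sim k) (Z k)).
move=> k m1 m2 m3 Mm1 Mm2 Mm3 Pm r r1 D _.
case keyE: (ce_keygen r) => [sk pk]; cbv zeta.
(* [ce_condenc] of the construction unfolds to a [dmap (pair true)], so the flag moves into [D] on
   both sides. *)
rewrite pr_accept_dmap [X in (_ - X)%R]pr_accept_dmap.
have := priv k sk pk (ex_intro _ r keyE) 1%N _ (C_ok k m2 m3 Mm2 Mm3)
  [ffun=> m1] [ffun=> he_enc pk m1 r1].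
(* The simulator's input becomes [Z k]. The distinguisher is chosen after the keys, messages and
   ciphertext, so it carries them as constants and reads only its challenge [y.2]. *)
rewrite CE // Pm; move=> /(_ _ _ (fun y =>
  D (sk, pk, m1, m2, m3, (false, he_enc pk m1 r1), (true, y.2)))).
apply=> i; first by rewrite ffunE (subsetP (sub_M k)).
by exists r1; rewrite !ffunE.
Qed.
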